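(* Let $\mu$ be a symmetric Borel probability measure on $\mathbb{R}$ with finite variance, and let $0<\alpha<\ln 2$. Then there exist numbers $\beta_i,\lambda_i$, $i=1,2$, depending on $\alpha$ and $\mu$ only, such that $$0\le\beta_i\le\lambda_i\ \text{ for } i=1,2,\qquad \lambda_1+\lambda_2=1,$$ and the following holds. Let $S_n^i$ be the Hamming sphere of radius $\beta_i n+o(n)$ in the Boolean cube of dimension $\lambda_i n+o(n)$, $i=1,2$ (the two dimensions adding up to $n$), and let $Y_n=S_n^1\times S_n^2$ be the direct product of the spheres considered as a subset of the Boolean cube $\{0,1\}^n$. Then $$\ln|Y_n|=\alpha n+o(n),$$ and for any sequence of sets $X_n\subset\{0,1\}^n$ such that $\ln|X_n|=\alpha n+o(n)$, we have $$\Gamma(Y_n,\mu)\le\Gamma(X_n,\mu)+o(n).$$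
   Context: A measure $\mu$ on $\mathbb{R}$ is symmetric if $\mu(A)=\mu(-A)$ for all Borel $A$. $|X|$ is the cardinality of $X$. For a non-empty $X\subset\{0,1\}^n$, $$\Gamma(X,\mu)=\mathbf{E}\max_{x\in X}\langle c,x\rangle,$$ where $c=(\gamma_1,\ldots,\gamma_n)$ has independent coordinates with distribution $\mu$ and $\langle\cdot,\cdot\rangle$ is the standard scalar product. The Hamming sphere of radius $r$ in the Boolean cube $\{0,1\}^d$ (integers $0\le r\le d$) is the set of $(\xi_1,\ldots,\xi_d)\in\{0,1\}^d$ with $\xi_1+\cdots+\xi_d=r$. The notation $o(n)$ refers to $n\to\infty$; the radii and dimensions are integers, and the statement holds for any choice of integer sequences of radii and dimensions with the indicated asymptotics. *)

(* Defs.v *)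
From HB Require Import structures.
From mathcomp Require Import all_boot all_order all_algebra.
From mathcomp Require Import all_classical all_reals all_analysis.

Set Implicit Arguments.
Unset Strict Implicit.
Unset Printing Implicit Defensive.

Import Order.TTheory GRing.Theory Num.Theory.
Import numFieldNormedType.Exports.

Local Open Scope classical_set_scope.
Local Open Scope ring_scope.

Definition symmetric_measure (R : realType)
    (mu : set (measurableTypeR R) -> \bar R) : Prop :=
  forall A : set (measurableTypeR R), measurable A ->
    mu A = mu [set - x | x in A].

Section power_measure.
Context d (T : measurableType d) (R : realType).

Definition tuple_cons n (z : T * n.-tuple T) : n.+1.-tuple T :=
  [tuple of z.1 :: z.2].

Lemma measurable_tuple_cons n : measurable_fun setT (@tuple_cons n).
Proof. exact: measurable_cons. Qed.

HB.instance Definition _ n :=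
  isMeasurableFun.Build _ _ _ _ (@tuple_cons n) (@measurable_tuple_cons n).

(* The n-fold product of mu: the joint law of n independent coordinates, each
   distributed according to mu (see power_measure_box). *)
Fixpoint power_measure (mu : probability T R) n : probability (n.-tuple T) R :=
  if n is m.+1 then
    distribution (mu \x power_measure mu m)%E (@tuple_cons m)
  else \d_([tuple] : 0.-tuple T).

Lemma power_measure_box (mu : probability T R) n (A : 'I_n -> set T) :
  (forall i, measurable (A i)) ->
  power_measure mu n [set c | forall i, A i (tnth c i)] =
  (\prod_(i < n) mu (A i))%E.
Proof.
elim: n A => [|n IHn] A mA /=.
  by rewrite big_ord0 diracE mem_set// => -[].
have mbox : measurable [set c : n.-tuple T | forall i, A (lift ord0 i) (tnth c i)].
  rewrite (_ : mkset _ = \bigcap_i (@tnth n T ^~ i @^-1` A (lift ord0 i))).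
    apply: fin_bigcap_measurable => // i _.
    by rewrite -[X in measurable X]setTI; exact: measurable_tnth.
  by apply/seteqP; split => [c Ac i _|c Ac i]; [exact: Ac|exact: (Ac i)].
rewrite /distribution /pushforward.
rewrite (_ : _ @^-1` _ =
  A ord0 `*` [set c | forall i, A (lift ord0 i) (tnth c i)]).
  rewrite product_measure1E// big_ord_recl; congr (_ * _)%E.
  exact: (IHn (fun i => A (lift ord0 i))).
apply/seteqP; split => [[x c] /= Axc|[x c] /= [Ax Ac] i].
  by split=> [|i]; [exact: (Axc ord0)|have := Axc (lift ord0 i); rewrite tnthS].
by case: (unliftP ord0 i) => [j|] ->; rewrite ?tnthS//; exact: Ac.
Qed.

End power_measure.

Definition dot (R : realType) n (c : n.-tuple R) (x : n.-tuple bool) : R :=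
  \sum_(i < n) tnth c i * (tnth x i)%:R.

(* The value -oo is only taken as the maximum over the empty set. *)
Definition Gamma (R : realType) n (X : {set n.-tuple bool})
    (mu : probability (measurableTypeR R) R) : \bar R :=
  (\int[power_measure mu n]_c \big[maxe/-oo]_(x in X) (dot c x)%:E)%E.

Definition hamming_sphere (d r : nat) : {set d.-tuple bool} :=
  [set x : d.-tuple bool | (\sum_(i < d) tnth x i)%N == r]%SET.

(* The direct product is taken directly inside the cube of dimension n, to
   which concatenations of x and y belong when d1 + d2 = n; this avoids a cast
   from (d1 + d2).-tuple bool. *)
Definition cube_prod n d1 d2 (A : {set d1.-tuple bool})
    (B : {set d2.-tuple bool}) : {set n.-tuple bool} :=
  [set z : n.-tuple bool |
    [exists x in A, exists y in B, val z == val x ++ val y]]%SET.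

(* Main.v *)
Require Import Defs.
From HB Require Import structures.
From mathcomp Require Import all_boot all_order all_algebra.
From mathcomp Require Import all_classical all_reals all_analysis.
From mathcomp Require Import measurable_realfun.
From mathcomp Require Import ring lra.
Import Order.TTheory GRing.Theory Num.Theory.
Import numFieldNormedType.Exports.
Local Open Scope classical_set_scope.
Local Open Scope ring_scope.

(** Write gamma for a random variable with law mu, H(p) for the entropy
    - p ln p - (1 - p) ln (1 - p), and put
      g(t) = E max(gamma - t, 0)    and    psi(p) = inf_t (p t + g(t)),
    so that psi(p) is the mean of gamma restricted to its top fraction p (the
    integral of the quantile function of mu over [1 - p, 1]).  The theorem says
    that min Gamma(X) / n over the sets X with ln|X| ~ alpha n is asymptotically
    the value at alpha of the lower convex envelope of the plane curve
    p |-> (H(p), psi(p)), where p runs over [0, 1].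

    Upper bound.  A Hamming sphere of radius p d in dimension d has about
    exp(d H(p)) points [cvg_ln_bin], and on a sphere of radius r the linear form
    <c, x> is at most t r + sum_i max(c_i - t, 0), whatever t is.  Taking
    expectations [Gamma_product_spheres] and optimizing over t, a product of two
    spheres realizes any convex combination of two points of the curve.

    Lower bound.  If the affine function h |-> a h - b lies below the curve,
    i.e. a H(p) - b <= psi(p) for all p, then Gamma(X) >= a ln|X| - b n for every
    non-empty X [Gamma_lower].  This goes by induction on n.  Split X into its
    faces X_0, X_1 according to the first coordinate and let M_0, M_1 be the
    maxima of the linear form over the faces.  By convexity of the maximum,
      Gamma(X) = E max(M_0, M_1 + gamma) >= E max(G_0, G_1 + gamma)
               = G_0 + g(G_0 - G_1) >= (1 - p) G_0 + p G_1 + psi(p)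
    with G_i = Gamma(X_i) and any p in [0, 1].  For p = |X_1| / |X| the
    induction hypothesis and the chain rule of entropy
      (1 - p) ln|X_0| + p ln|X_1| = ln|X| - H(p)
    give the claim.

    The two bounds meet along a line that supports the curve from below at the
    abscissa alpha: such a line touches the curve at two points p_1, p_2 with
    H(p_1) <= alpha <= H(p_2) [supporting_chord], and the convex combination of
    these points that has abscissa alpha provides lambda_i and
    beta_i = lambda_i p_i.  The touching points exist because the curve is
    compact, which rests on the continuity of psi up to the end points 0 and 1
    [continuous_conj_excess].  As mu has mean 0 and finite variance, g(t) and
    t + g(t) = E max(t - gamma, 0) become small as t --> +oo and t --> -oo, so
    that psi vanishes continuously at both end points. *)

Set Implicit Arguments.
Unset Strict Implicit.
Unset Printing Implicit Defensive.

(** * Supporting lines of a compact curve *)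

(** The existence of a line below a compact curve (H, psi) that touches it on both
    sides of a prescribed abscissa. For a slope a, consider the gap
    f a p = a (alpha - H p) + psi p: its minimum over p is the height at alpha of
    the highest line of slope a below the curve. Minimized over the part
    H p >= alpha only, the gap is nonincreasing in a; over the part H p <= alpha
    it is nondecreasing. At the slope where both minima agree, the line touches
    the curve in both parts. *)
Lemma supporting_chord (R : realType) (T : topologicalType) (K : set T)
    (H psi : T -> R) (alpha : R) (lo hi : T) :
  compact K -> hausdorff_space T -> continuous H -> {within K, continuous psi} ->
  (forall p, K p -> 0 <= psi p) -> K lo -> K hi -> H lo < alpha < H hi ->
  exists a b l p1 p2,
    [/\ K p1 /\ K p2, 0 <= l <= 1, l * H p1 + (1 - l) * H p2 = alpha,
        forall p, K p -> a * H p - b <= psi p &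
        a * H p1 - b = psi p1 /\ a * H p2 - b = psi p2].
Proof.
move=> cK hT cH cpsi psi0 Klo Khi /andP[Hlo Hhi].
pose f a p := a * (alpha - H p) + psi p.
have [C [C0 HC]] : exists C : R, 0 <= C /\ forall p, K p -> `|alpha - H p| <= C.
  have [M [_ HM]] : bounded_set ((fun p => alpha - H p) @` K).
    apply/compact_bounded/continuous_compact => //.
    apply: continuous_subspaceT => x.
    by apply: cvgB; [exact: cvg_cst|exact: cH].
  exists (`|M| + 1); split => [|p Kp]; first by rewrite addr_ge0.
  by apply: HM; [rewrite (le_lt_trans (ler_norm _))// ltrDl|exists p].
(* The minimum of the gap over a closed part S of K is Lipschitz in the slope. *)
have minf (S : set T) p0 : S `<=` K -> closed S -> S p0 ->
    exists m : R -> R, continuous m /\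
      (forall a p, S p -> m a <= f a p) /\
      forall a, exists2 p, S p & f a p = m a.
  move=> SK clS Sp0.
  have ex a : exists p, S p /\ forall q, S q -> f a p <= f a q.
    have [||p + pmin] := @compact_EVT_min T R (f a) S (ex_intro _ p0 Sp0).
    - exact: subclosed_compact cK SK.
    - apply: (continuous_subspaceW SK) => x.
      apply: cvgD; last exact: cpsi.
      apply: cvgM; first exact: cvg_cst.
      apply: cvgB; first exact: cvg_cst.
      exact: (continuous_subspaceT cH).
    by rewrite inE => Sp; exists p; split=> // q Sq; apply: pmin; rewrite inE.
  have /choice[c cP] := ex.
  have lip a b : f a (c a) <= f b (c b) + C * `|a - b|.
    have [Sb minb] := cP b; have [_ mina] := cP a.
    apply: (le_trans (mina _ Sb)).
    have -> : f a (c b) = f b (c b) + (alpha - H (c b)) * (a - b).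
      by rewrite /f; ring.
    rewrite lerD2l (le_trans (ler_norm _))// normrM ler_wpM2r//.
    exact/HC/SK.
  exists (fun a => f a (c a)); split; last first.
    split=> [a p Sp|a]; first exact: (cP a).2.
    by exists (c a) => //; exact: (cP a).1.
  move=> a; apply/cvgrPdist_le => e e0.
  have C1 : 0 < C + 1 by rewrite ltr_wpDl.
  have nb : \forall b \near a, `|a - b| <= e / (C + 1).
    have /cvgrPdist_le : b @[b --> a] --> a by exact: cvg_id.
    by move=> /(_ (e / (C + 1))); apply; exact: divr_gt0.
  apply: filterS nb => b; rewrite ler_pdivlMr// => ab.
  apply: (@le_trans _ _ (C * `|a - b|)).
    rewrite ler_norml; apply/andP; split.
      by have := lip b a; rewrite distrC; lra.
    by have := lip a b; lra.
  have := normr_ge0 (a - b); lra.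
have cl (S : set R) : closed S -> closed (K `&` H @^-1` S).
  move=> clS; apply: closedI; first exact: compact_closed.
  by apply: preimage_closed => // x _; exact: cH.
have [mh [cmh [mhle mhex]]] := minf (K `&` H @^-1` [set x | alpha <= x]) hi
  (@subIsetl _ _ _) (cl _ (@closed_ge _ _)) (conj Khi (ltW Hhi)).
have [ml [cml [mlle mlex]]] := minf (K `&` H @^-1` [set x | x <= alpha]) lo
  (@subIsetl _ _ _) (cl _ (@closed_le _ _)) (conj Klo (ltW Hlo)).
(* The slopes at which the gap vanishes at lo, respectively at hi. *)
pose a0 := - (psi lo / (alpha - H lo)); pose a1 := psi hi / (H hi - alpha).
have a00 : a0 <= 0 by rewrite oppr_le0 divr_ge0 ?psi0// subr_ge0 ltW.
have a10 : 0 <= a1 by rewrite divr_ge0 ?psi0// subr_ge0 ltW.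
have [a _ mlh] : exists2 c, c \in `[a0, a1] & (ml \- mh) c = 0.
  apply: IVT; first exact: le_trans a10.
    by apply: continuous_subspaceT => x; apply: cvgB; [exact: cml|exact: cmh].
  rewrite ge_min le_max; apply/andP; split; apply/orP; [left|right] => /=.
    rewrite subr_le0; apply: (le_trans (mlle _ lo (conj Klo (ltW Hlo)))).
    have -> : f a0 lo = 0.
      by rewrite /f /a0 mulNr divfK ?addNr// subr_eq0 gt_eqF.
    have [p [Kp Hp] <-] := mhex a0.
    by rewrite addr_ge0 ?psi0// mulr_le0// subr_le0.
  rewrite subr_ge0; apply: (le_trans (mhle _ hi (conj Khi (ltW Hhi)))).
  have -> : f a1 hi = 0.
    by rewrite /f /a1 -[alpha - _]opprB mulrN divfK ?addNr// subr_eq0 gt_eqF.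
  have [p [Kp Hp] <-] := mlex a1.
  by rewrite addr_ge0 ?psi0// mulr_ge0// subr_ge0.
move/eqP: mlh; rewrite subr_eq0 => /eqP mlh.
have [p1 [Kp1 Hp1] fp1] := mlex a.
have [p2 [Kp2 Hp2] fp2] := mhex a.
have fmin p : K p -> ml a <= f a p.
  move=> Kp; have [Hp|/ltW Hp] := leP (H p) alpha; first exact: mlle.
  by rewrite mlh; apply: mhle.
have [l l01 lH] : exists2 l, 0 <= l <= 1 & l * H p1 + (1 - l) * H p2 = alpha.
  have [E|NE] := eqVneq (H p1) (H p2).
    exists 0; first by rewrite lexx ler01.
    by move: Hp1 Hp2; rewrite /= E => ? ?; lra.
  have lt12 : 0 < H p2 - H p1.
    by rewrite subr_gt0 lt_neqAle NE (le_trans Hp1 Hp2).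
  exists ((H p2 - alpha) / (H p2 - H p1)).
    rewrite divr_ge0 ?ler_pdivrMr ?mul1r; move: Hp1 Hp2 => /= ? ?; lra.
  by field; rewrite gt_eqF.
exists a, (a * alpha - ml a), l, p1, p2; split=> //.
- by move=> p Kp; have := fmin _ Kp; rewrite /f; lra.
- split; first by rewrite -fp1 /f; ring.
  by rewrite mlh -fp2 /f; ring.
Qed.

(** * The concave conjugate psi of the mean excess *)

(** When g t is the mean of (gamma - t)^+, this is the largest mean of gamma w over
    the random weights 0 <= w <= 1 of mean p, in its dual form. *)
Definition conj_excess (R : realType) (g : R -> R) (p : R) : R :=
  inf (range (fun t => p * t + g t)).

Section conj_excess.
Context (R : realType) (g : R -> R).
Hypothesis g_ge0 : forall t, 0 <= g t.
Hypothesis g_geN : forall t, 0 <= t + g t.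
Local Notation psi := (conj_excess g).

Lemma affine_excess_ge0 p t : 0 <= p <= 1 -> 0 <= p * t + g t.
Proof.
move=> /andP[p0 p1].
have -> : p * t + g t = p * (t + g t) + (1 - p) * g t by ring.
by rewrite addr_ge0// mulr_ge0// subr_ge0.
Qed.

Lemma conj_excess_le p t : 0 <= p <= 1 -> psi p <= p * t + g t.
Proof.
move=> p01; apply: ge_inf; last by exists t.
by exists 0 => _ [s _ <-]; exact: affine_excess_ge0.
Qed.

Lemma conj_excess_near p e : 0 <= p <= 1 -> 0 < e ->
  exists t, p * t + g t <= psi p + e.
Proof.
move=> p01 e0.
have [|_ [t _ <-] /ltW h] :=
  @inf_adherent R _ e e0 (_ : has_inf (range (fun t => p * t + g t))).
  split; first by exists (p * 0 + g 0); exists 0.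
  by exists 0 => _ [s _ <-]; exact: affine_excess_ge0.
by exists t.
Qed.

Lemma conj_excess_ge p c : (forall t, c <= p * t + g t) -> c <= psi p.
Proof.
move=> h; apply: lb_le_inf; first by exists (p * 0 + g 0); exists 0.
by move=> _ [s _ <-].
Qed.

Lemma conj_excess_ge0 p : 0 <= p <= 1 -> 0 <= psi p.
Proof. by move=> p01; apply: conj_excess_ge => t; exact: affine_excess_ge0. Qed.

(** The next two inequalities are concavity together with non-negativity at the
    end points 0 and 1; they give a Lipschitz bound inside [0, 1]. *)
Lemma conj_excess_scale0 p q : 0 <= q -> q <= p -> p <= 1 ->
  q * psi p <= p * psi q.
Proof.
move=> q0 qp p1; have [pE|pN0] := eqVneq p 0.
  have -> : q = 0 by lra.
  by rewrite pE !mul0r.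
have p0 : 0 < p by rewrite lt_neqAle eq_sym pN0 (le_trans q0).
rewrite -ler_pdivrMl//; apply: conj_excess_ge => t.
rewrite ler_pdivrMl//.
have h : psi p <= p * t + g t by apply: conj_excess_le; rewrite ltW.
apply: (le_trans (ler_wpM2l q0 h)).
have := mulr_ge0 (_ : 0 <= p - q) (g_ge0 t); rewrite subr_ge0 => /(_ qp).
lra.
Qed.

Lemma conj_excess_scale1 p q : 0 <= q -> q <= p -> p <= 1 ->
  (1 - p) * psi q <= (1 - q) * psi p.
Proof.
move=> q0 qp p1; have [E|qN1] := eqVneq q 1.
  have -> : p = 1 by lra.
  by rewrite E lexx.
have q1 : 0 < 1 - q by rewrite subr_gt0 lt_neqAle qN1 (le_trans qp).
rewrite -ler_pdivrMl//; apply: conj_excess_ge => t.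
rewrite ler_pdivrMl//.
have h : psi q <= q * t + g t by apply: conj_excess_le; lra.
have p1' : 0 <= 1 - p by rewrite subr_ge0.
apply: (le_trans (ler_wpM2l p1' h)).
have := mulr_ge0 (_ : 0 <= p - q) (g_geN t); rewrite subr_ge0 => /(_ qp).
lra.
Qed.

Lemma conj_excess_dist p q : 0 <= p <= 1 -> 0 <= q <= 1 ->
  p * (1 - p) * `|psi p - psi q| <= g 0 * `|p - q|.
Proof.
move=> p01 q01; have /andP[p0 p1] := p01; have /andP[q0 q1] := q01.
have pB := conj_excess_le 0 p01; rewrite mulr0 add0r in pB.
have P0 := conj_excess_ge0 p01; have Q0 := conj_excess_ge0 q01.
have p1' : 0 <= 1 - p by rewrite subr_ge0.
have shrink (w x c : R) : 0 <= w <= 1 -> 0 <= c -> x <= c -> w * x <= c.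
  by move=> /andP[w0 w1] c0 xc; have := ler_wpM2l w0 xc; nra.
(* psi p - psi q and its opposite are bounded through the two scaling
   inequalities, one carrying the weight p and the other the weight 1 - p. *)
have c0 : 0 <= g 0 * `|p - q| by rewrite mulr_ge0.
have w0 : 0 <= 1 - p <= 1 by lra.
rewrite -[p * (1 - p)]ger0_norm; last by rewrite mulr_ge0.
rewrite -normrM ler_norml lerNl -mulrN opprB; apply/andP.
have [qp|/ltW pq] := leP q p.
  have s0 := conj_excess_scale0 q0 qp p1.
  have s1 := conj_excess_scale1 q0 qp p1.
  have : (p - q) * psi p <= g 0 * `|p - q|.
    by rewrite ger0_norm ?subr_ge0// mulrC ler_wpM2r// subr_ge0.
  split; [rewrite -mulrA|rewrite (mulrC p) -mulrA]; apply: shrink => //; lra.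
have s0 := conj_excess_scale0 p0 pq q1.
have s1 := conj_excess_scale1 p0 pq q1.
have : (q - p) * psi p <= g 0 * `|p - q|.
  by rewrite distrC ger0_norm ?subr_ge0// mulrC ler_wpM2r// subr_ge0.
split; [rewrite (mulrC p) -mulrA|rewrite -mulrA]; apply: shrink => //; lra.
Qed.

Hypothesis g_small : forall e, 0 < e -> exists t, g t <= e.
Hypothesis gN_small : forall e, 0 < e -> exists t, t + g t <= e.

(** At an end point the infimum is 0 but need not be attained, so continuity there
    is obtained by comparison with a single affine function p |-> p t + g t whose
    value at the end point is small. *)
Lemma continuous_conj_excess : {within `[0, 1], continuous psi}.
Proof.
apply/subspace_continuousP => p; rewrite /= in_itv/= => p01.
apply/cvgrPdist_le => e e0.
have near_small (d : R) : 0 < d -> \forall q \near p, `|p - q| <= d.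
  have /cvgrPdist_le : q @[q --> p] --> p by exact: cvg_id.
  exact.
have /andP[p0 p1] := p01.
have [pN|pN] := eqVneq (p * (1 - p)) 0.
  have [t gt] : exists t, p * t + g t <= e / 2.
    have e2 : 0 < e / 2 by rewrite divr_gt0.
    move/eqP: pN; rewrite mulf_eq0 subr_eq0 => /orP[/eqP ->|/eqP <-].
      by have [t ?] := g_small e2; exists t; rewrite mul0r add0r.
    by have [t ?] := gN_small e2; exists t; rewrite mul1r.
  have t1 : 0 < `|t| + 1 by rewrite ltr_wpDl.
  have d0 : 0 < e / 2 / (`|t| + 1) by rewrite !divr_gt0.
  apply: filterS (near_small _ d0) => q pq; rewrite /= in_itv/= => q01.
  have := conj_excess_le t p01; have := conj_excess_le t q01.
  have := conj_excess_ge0 p01; have := conj_excess_ge0 q01.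
  have : `|(q - p) * t| <= e / 2.
    rewrite normrM distrC.
    move: pq; rewrite ler_pdivlMr// => pq.
    have := normr_ge0 (p - q); have := normr_ge0 t; nra.
  rewrite ler_norml => /andP[_ h] h1 h2 h3 h4.
  rewrite ler_norml; apply/andP; split; lra.
have pp : 0 < p * (1 - p) by rewrite lt_neqAle eq_sym pN mulr_ge0// subr_ge0.
have g1 : 0 < g 0 + 1 by rewrite ltr_wpDl.
have d0 : 0 < e * (p * (1 - p)) / (g 0 + 1) by rewrite !divr_gt0// mulr_gt0.
apply: filterS (near_small _ d0) => q pq; rewrite /= in_itv/= => q01.
rewrite -(ler_pM2l pp) (le_trans (conj_excess_dist p01 q01))//.
move: pq; rewrite ler_pdivlMr// => pq.
have := normr_ge0 (p - q); nra.
Qed.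
End conj_excess.

(** * Entropy and the exponential growth of binomial coefficients *)

(** Turns the asymptotic notation into limits of quotients, which can be combined
    with the algebra of limits. *)
Lemma littleo_natP (R : realType) (f : nat -> R) :
  f =o_\oo (fun n => n%:R : R) <-> f n / n%:R @[n --> \oo] --> (0 : R).
Proof.
rewrite eqoP; split=> h.
  apply/cvgrPdist_le => e e0; near=> n.
  rewrite sub0r normrN normrM normfV ler_pdivrMr; first by near: n; exact: h.
  by rewrite normr_gt0 pnatr_eq0 -lt0n; near: n; exact: nbhs_infty_gt.
move=> e e0; move/cvgrPdist_le : h => /(_ _ e0) h.
near=> n.
have : `|0 - f n / n%:R| <= e by near: n.
rewrite sub0r normrN normrM normfV ler_pdivrMr//.
by rewrite normr_gt0 pnatr_eq0 -lt0n; near: n; exact: nbhs_infty_gt.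
Unshelve. all: by end_near.
Qed.

Definition xlnx (R : realType) (x : R) : R := x * ln x.

Definition entropy (R : realType) (p : R) : R := - xlnx p - xlnx (1 - p).

(** The homogeneous form of the entropy: d H(r / d), but still meaningful and
    continuous for d = 0, which is needed when one of the two spheres has
    dimension o(n). *)
Definition ln_bin_rate (R : realType) (d r : R) : R :=
  xlnx d - xlnx r - xlnx (d - r).

Section entropy.
Context (R : realType).
Implicit Types (x c p : R) (n d r : nat).

Lemma xlnx0 : xlnx (0 : R) = 0. Proof. exact: mul0r. Qed.

Lemma xlnx1 : xlnx (1 : R) = 0. Proof. by rewrite /xlnx ln1 mulr0. Qed.

Lemma sqrtr_sqr_ge0 x : 0 <= x -> Num.sqrt (x ^+ 2) = x.
Proof. by move=> x0; rewrite sqrtr_sqr ger0_norm. Qed.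

(** Quantitative form of x ln x --> 0: apply ln u < u to u = 1 / sqrt x. *)
Lemma mulNlnx_le x : 0 < x <= 1 -> - ln x * x <= 2 * Num.sqrt x.
Proof.
move=> /andP[x0 x1]; have s0 : 0 < Num.sqrt x by rewrite sqrtr_gt0.
have /ln_sublinear : 0 < (Num.sqrt x)^-1 by rewrite invr_gt0.
rewrite lnV ?posrE// -(ltr_pM2r s0) mulVf ?gt_eqF// => h.
rewrite -{1 2}(sqr_sqrtr (ltW x0)) lnXn// expr2.
have := ltr_pM2r s0 (- ln (Num.sqrt x) * Num.sqrt x) 1.
rewrite h mul1r mulr2n; nra.
Qed.

Lemma continuous_xlnx : continuous (@xlnx R).
Proof.
move=> x; have [x0|x0] := ltP 0 x.
  by apply: continuousM; [exact: cvg_id|exact: continuous_ln].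
have E y : y <= 0 -> xlnx y = 0 by move=> y0; rewrite /xlnx ln0// mulr0.
rewrite /continuous_at E//; apply/cvgrPdist_le => e e0.
have m0 : x < Num.min 1 ((e / 2) ^+ 2).
  by rewrite (le_lt_trans x0)// lt_min ltr01 exprn_gt0// divr_gt0.
near=> y; have : y < Num.min 1 ((e / 2) ^+ 2) by near: y; exact: lt_nbhsl.
rewrite lt_min => /andP[/ltW y1 ye]; rewrite sub0r normrN.
have [y0|y0] := ltP 0 y; last by rewrite E// normr0 ltW.
rewrite ler0_norm; last by rewrite mulr_ge0_le0 ?ln_le0// ltW.
rewrite /xlnx mulrC -mulNr (le_trans (mulNlnx_le _)) ?y0//.
have e2 : 0 <= e / 2 by rewrite divr_ge0// ltW.
have : Num.sqrt y <= e / 2 by rewrite -(sqrtr_sqr_ge0 e2) ler_wsqrtr// ltW.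
lra.
Unshelve. all: by end_near.
Qed.

Lemma xlnxM c x : 0 < c -> 0 <= x -> xlnx (c * x) = c * xlnx x + x * xlnx c.
Proof.
move=> c0; rewrite le0r => /orP[/eqP->|x0].
  by rewrite mulr0 xlnx0 mulr0 mul0r addr0.
by rewrite /xlnx lnM ?posrE//; ring.
Qed.

Lemma entropy0 : entropy (0 : R) = 0.
Proof. by rewrite /entropy subr0 xlnx0 xlnx1; ring. Qed.

Lemma entropy_half : entropy (2^-1 : R) = ln 2.
Proof.
rewrite /entropy /xlnx (_ : 1 - 2^-1 = 2^-1 :> R); last by field.
by rewrite lnV ?posrE//; field.
Qed.

(** The chain rule of entropy for a uniform random element of a set that is split
    into parts of sizes a and b. *)
Lemma entropy_chain (a b : R) : 0 < a -> 0 < b -> 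
  (1 - b / (a + b)) * ln a + b / (a + b) * ln b = ln (a + b) - entropy (b / (a + b)).
Proof.
move=> a0 b0; have ab : 0 < a + b by rewrite addr_gt0.
rewrite /entropy /xlnx (_ : 1 - b / (a + b) = a / (a + b)); last by field; rewrite gt_eqF.
rewrite !ln_div ?posrE//; field; rewrite gt_eqF//.
Qed.

Lemma ln_bin_rateM c (x y : R) : 0 < c -> 0 <= y <= x ->
  ln_bin_rate (c * x) (c * y) = c * ln_bin_rate x y.
Proof.
move=> c0 /andP[y0 yx]; rewrite /ln_bin_rate -mulrBr !xlnxM//; last 2 first.
- by rewrite subr_ge0.
- exact: le_trans yx.
ring.
Qed.

Lemma ln_bin_rate_entropy (l p : R) : 0 <= l -> 0 <= p <= 1 ->
  ln_bin_rate l (l * p) = l * entropy p.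
Proof.
rewrite le0r => /orP[/eqP->|l0] p01.
  by rewrite /ln_bin_rate !mul0r subr0 xlnx0; ring.
rewrite -{1}(mulr1 l) ln_bin_rateM// /ln_bin_rate xlnx1 /entropy; ring.
Qed.

(** A weak Stirling formula. Both induction steps are instances of
    ln (1 + u) <= u, at u = 1 / n and at u = - 1 / (n + 1). *)
Lemma ln_fact_bounds n :
  xlnx (n%:R : R) - n%:R <= ln (n`!%:R) <= xlnx (n%:R : R) - n%:R + 1 + ln n%:R.
Proof.
elim: n => [|n IHn].
  by rewrite fact0 ln1 xlnx0 ln0//; lra.
have [->|n0] := posnP n; first by rewrite factS fact0 muln1 ln1 xlnx1; lra.
have nR : 0 < n%:R :> R by rewrite ltr0n.
have n1R : 0 < n.+1%:R :> R by rewrite ltr0n.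
rewrite factS natrM lnM ?posrE ?ltr0n ?fact_gt0//.
have lo : n%:R * (ln n.+1%:R - ln n%:R) <= 1 :> R.
  rewrite -ln_div ?posrE//.
  have -> : n.+1%:R / n%:R = 1 + n%:R^-1 :> R.
    by rewrite -natr1; field; rewrite gt_eqF.
  rewrite -ler_pdivlMl// mulr1; apply: le_ln1Dx.
  by rewrite (lt_le_trans (_ : _ < 0))// invr_ge0 ltW.
have up : 1 <= n.+1%:R * (ln n.+1%:R - ln n%:R) :> R.
  rewrite -lerN2 -mulrN opprB -ln_div ?posrE//.
  have -> : n%:R / n.+1%:R = 1 + (- n.+1%:R^-1) :> R.
    by rewrite -[n.+1%:R]natr1; field; rewrite natr1 gt_eqF.
  rewrite -ler_pdivlMl// mulrN1; apply: le_ln1Dx.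
  by rewrite ltrN2 invf_lt1// ltr1n ltnS.
move: IHn => /andP[l u]; move: lo up l u; rewrite /xlnx -natr1 => lo up l u.
apply/andP; split; lra.
Qed.

Lemma ln_nat_ge0 n : 0 <= ln n%:R :> R.
Proof. by case: n => [|n]; [rewrite ln0|rewrite ln_ge0// ler1n]. Qed.

Lemma cvg_ln_nat_div : ln n%:R / n%:R @[n --> \oo] --> (0 : R).
Proof.
apply/cvgrPdist_le => e e0; near=> n.
have n0 : (0 < n)%N by near: n; exact: nbhs_infty_gt.
have nR : 0 < n%:R :> R by rewrite ltr0n.
rewrite sub0r normrN ger0_norm ?divr_ge0 ?ln_nat_ge0//.
have -> : ln n%:R / n%:R = - ln (n%:R^-1) * n%:R^-1 :> R.
  by rewrite lnV ?posrE// opprK.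
rewrite (le_trans (mulNlnx_le _))//.
  by rewrite invr_gt0 nR invf_le1// ler1n.
have e2 : 0 <= e / 2 by rewrite divr_ge0// ltW.
suff : Num.sqrt (n%:R^-1) <= e / 2 by lra.
rewrite -(sqrtr_sqr_ge0 e2) ler_wsqrtr//.
have e4 : 0 < (e / 2) ^+ 2 by rewrite exprn_gt0// divr_gt0.
rewrite invf_ple ?posrE//.
by near: n; exact: nbhs_infty_ger.
Unshelve. all: by end_near.
Qed.

Lemma le_ln_nat (m n : nat) : (m <= n)%N -> ln m%:R <= ln n%:R :> R.
Proof.
case: m => [|m] mn; first by rewrite ln0// ln_nat_ge0.
by rewrite ler_ln ?posrE ?ltr0n ?ler_nat// (leq_trans _ mn).
Qed.

Lemma ln_bin_dist d r : (r <= d)%N ->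
  `|ln 'C(d, r)%:R - ln_bin_rate (d%:R : R) r%:R| <= 2 + 2 * ln d%:R.
Proof.
move=> rd; have := ln_fact_bounds d; have := ln_fact_bounds r.
have := ln_fact_bounds (d - r); rewrite -(bin_fact rd) !natrM.
rewrite !lnM ?posrE ?mulr_gt0 ?ltr0n ?fact_gt0 ?bin_gt0//.
have := le_ln_nat rd; have := le_ln_nat (leq_subr r d).
rewrite /ln_bin_rate natrB// => h1 h2 /andP[h3 h4] /andP[h5 h6] /andP[h7 h8].
have := ln_nat_ge0 r; have := ln_nat_ge0 (d - r); have := ln_nat_ge0 d.
move=> ? ? ?; rewrite ler_norml; apply/andP; split; lra.
Qed.

Lemma cvg_natV : n%:R^-1 @[n --> \oo] --> (0 : R).
Proof.
apply/cvgrPdist_le => e e0; near=> n.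
have nR : 0 < n%:R :> R by rewrite ltr0n; near: n; exact: nbhs_infty_gt.
rewrite sub0r normrN ger0_norm ?invr_ge0// invf_ple ?posrE//.
by near: n; exact: nbhs_infty_ger.
Unshelve. all: by end_near.
Qed.

Lemma cvg_ln_bin (r d : nat -> nat) (l b : R) :
  (forall n, (r n <= d n <= n)%N) ->
  (d n)%:R / n%:R @[n --> \oo] --> l -> (r n)%:R / n%:R @[n --> \oo] --> b ->
  ln 'C(d n, r n)%:R / n%:R @[n --> \oo] --> ln_bin_rate l b.
Proof.
move=> rdn cd cr.
have crate : ln_bin_rate ((d n)%:R / n%:R) ((r n)%:R / n%:R)
    @[n --> \oo] --> ln_bin_rate l b.
  have cx (f : nat -> R) c : f n @[n --> \oo] --> c ->
      xlnx (f n) @[n --> \oo] --> xlnx c.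
    by move=> fc; apply: continuous_cvg => //; exact: continuous_xlnx.
  by apply: cvgB; [apply: cvgB; exact: cx|apply: cx; exact: cvgB].
have cerr : (2 + 2 * ln n%:R) / n%:R @[n --> \oo] --> (0 : R).
  have -> : (0 : R) = 2 * 0 + 2 * 0 by ring.
  under eq_fun do rewrite mulrDl -(mulrA 2).
  apply: cvgD; apply: cvgM; try exact: cvg_cst; last exact: cvg_ln_nat_div.
  exact: cvg_natV.
apply/cvgrPdist_le => e e0.
have e2 : 0 < e / 2 by rewrite divr_gt0.
near=> n.
have n0 : (0 < n)%N by near: n; exact: nbhs_infty_gt.
have nR : 0 < n%:R :> R by rewrite ltr0n.
have /andP[rd dn] := rdn n.
have h1 : `|ln_bin_rate l b - ln_bin_rate ((d n)%:R / n%:R) ((r n)%:R / n%:R)|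
    <= e / 2.
  by near: n; move/cvgrPdist_le : crate; exact.
have h2 : (2 + 2 * ln n%:R) / n%:R <= e / 2.
  apply: le_trans (ler_norm _) _; rewrite -normrN -sub0r.
  by near: n; move/cvgrPdist_le : cerr; exact.
have h3 : ln_bin_rate ((d n)%:R / n%:R) ((r n)%:R / n%:R) =
    ln_bin_rate (d n)%:R (r n)%:R / n%:R :> R.
  have nN : n%:R != 0 :> R by rewrite gt_eqF.
  rewrite -[LHS](mulfK nN); congr (_ / _); rewrite mulrC.
  rewrite -ln_bin_rateM//; last first.
    by rewrite divr_ge0//= ler_pM2r ?invr_gt0// ler_nat.
  by rewrite ![_%:R * (_ / _)]mulrC !divfK ?gt_eqF.
have h4 := ln_bin_dist rd; have h5 := le_ln_nat dn.
rewrite h3 in h1.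
apply: le_trans (ler_distD (ln_bin_rate (d n)%:R (r n)%:R / n%:R) _ _) _.
rewrite [e](splitr e) lerD//; apply: le_trans h2.
rewrite -mulrBl normrM normfV (gtr0_norm nR) ler_pM2r ?invr_gt0// distrC.
by apply: le_trans h4 _; rewrite lerD2l ler_pM2l.
Unshelve. all: by end_near.
Qed.

End entropy.

(** * The mean excess of a single coordinate *)

Section one_coordinate.
Context (R : realType) (mu : probability (measurableTypeR R) R).
Local Open Scope ereal_scope.

Definition excess (t : R) : R := fine (\int[mu]_x (Num.max (x - t) 0)%:E).

(** Finiteness of the variance gives a finite second moment around some real m even
    before the mean is known to exist: in the variance, the expectation is cast to
    a real number, whatever its value. *)
Lemma sq_moment_of_variance :
  'V_mu[(idfun : measurableTypeR R -> R)] < +oo ->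
  exists m : R, \int[mu]_x ((x - m) ^+ 2)%:E < +oo.
Proof.
rewrite /variance covariance.unlock expectation.unlock => h.
by exists (fine (\int[mu]_x (idfun x)%:E)).
Qed.

Lemma measurable_sub_cst (t : R) :
  measurable_fun [set: measurableTypeR R] (fun x : R => (x - t)%R).
Proof. by exact: measurable_funB. Qed.

Lemma measurable_excess (t : R) :
  measurable_fun [set: measurableTypeR R] (fun x : R => Num.max (x - t) 0)%R.
Proof. by apply: measurable_maxr => //; exact: measurable_sub_cst. Qed.

Lemma measurable_sq_sub (t : R) :
  measurable_fun [set: measurableTypeR R] (fun x : R => (x - t) ^+ 2)%R.
Proof. by apply: measurable_funX; exact: measurable_sub_cst. Qed.

Lemma integrable_cst_prob (c : R) : mu.-integrable setT (cst c%:E).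
Proof. exact: finite_measure_integrable_cst. Qed.

Lemma integral_cst_prob (c : R) : \int[mu]_x c%:E = c%:E.
Proof.
rewrite integral_cst// -[RHS]mule1; congr (_ * _); exact: probability_setT.
Qed.

Lemma integrable_id (m : R) : \int[mu]_x ((x - m) ^+ 2)%:E < +oo ->
  mu.-integrable setT (fun x : measurableTypeR R => (x : R)%:E).
Proof.
move=> V.
have iV : mu.-integrable setT (fun x : measurableTypeR R => ((x - m) ^+ 2)%:E).
  apply/integrableP; split; first by apply/measurable_EFinP; exact: measurable_sq_sub.
  by under eq_integral do rewrite gee0_abs ?lee_fin ?sqr_ge0//.
have i1 := integrable_cst_prob (1 + `|m|).
apply: (le_integrable measurableT _ _ (integrableD measurableT iV i1)).
  by apply/measurable_EFinP.
move=> x _ /=; rewrite lee_fin.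
rewrite [leRHS]ger0_norm; last by rewrite addr_ge0 ?sqr_ge0// addr_ge0.
have := ler_normD ((x : R) - m)%R m; rewrite subrK.
have : (`|x - m| <= (x - m) ^+ 2 + 1)%R.
  by rewrite -[(_ ^+ 2)%R]real_normK ?num_real//; have := normr_ge0 ((x : R) - m)%R; nra.
lra.
Qed.

(** The map x |-> - x preserves mu, so the mean equals its opposite. *)
Lemma mean_symmetric : symmetric_measure mu ->
  mu.-integrable setT (fun x : measurableTypeR R => (x : R)%:E) ->
  \int[mu]_x (x : R)%:E = 0.
Proof.
move=> sym ix.
pose opp (x : measurableTypeR R) : measurableTypeR R := (- x)%R.
have mN : measurable_fun [set: measurableTypeR R] opp.
  exact: oppr_measurable.
have E : \int[mu]_x (x : R)%:E = \int[pushforward mu opp]_x (x : R)%:E.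
  apply: eq_measure_integral => A mA _.
  transitivity (mu [set - x | x in A]%R); first exact: sym.
  rewrite /pushforward; congr (mu _).
  apply/seteqP; split=> [_ [x Ax <-]|x Ax] /=; first by rewrite /opp opprK.
  by exists (- x)%R => //; rewrite /opp opprK.
have mE : measurable_fun [set: measurableTypeR R]
    (fun x : measurableTypeR R => (x : R)%:E) by apply/measurable_EFinP.
have iN : mu.-integrable setT
    ((fun x : measurableTypeR R => (x : R)%:E) \o
     opp).
  exact: (integrableN ix).
move: E; rewrite (integral_pushforward mN mE iN measurableT).
have -> : \int[mu]_(x in opp @^-1` setT)
    ((fun x : measurableTypeR R => (x : R)%:E) \o
     opp) x =
  - \int[mu]_x (x : R)%:E.
  rewrite -integralN; last exact: integrable_add_def.
  by apply: eq_integral.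
have /fineK <- : \int[mu]_x (x : R)%:E \is a fin_num by exact: integrable_fin_num.
rewrite -EFinN => -[] h; congr EFin; lra.
Qed.

Hypothesis ix : mu.-integrable setT (fun x : measurableTypeR R => (x : R)%:E).
Hypothesis mean0 : \int[mu]_x (x : R)%:E = 0.

Lemma integrable_shift (t : R) :
  mu.-integrable setT (fun x : measurableTypeR R => ((x : R) - t)%:E).
Proof.
have -> : (fun x : measurableTypeR R => ((x : R) - t)%:E) =
    (fun x : measurableTypeR R => (x : R)%:E) \- cst t%:E.
  by apply/funext => x /=; rewrite EFinB.
exact: integrableB (integrable_cst_prob t).
Qed.

Lemma integral_shift (t : R) : \int[mu]_x ((x : R) - t)%:E = (- t)%:E.
Proof.
under eq_integral do rewrite EFinB.
rewrite integralB//; last exact: integrable_cst_prob.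
by rewrite mean0 sub0e integral_cst_prob.
Qed.

Lemma integrable_excess (t : R) :
  mu.-integrable setT (fun x : measurableTypeR R => (Num.max ((x : R) - t) 0)%:E).
Proof.
apply: (le_integrable measurableT _ _ (integrable_shift t)).
  by apply/measurable_EFinP; exact: measurable_excess.
move=> x _ /=; rewrite lee_fin; case: (leP ((x : R) - t)%R 0%R) => // _.
by rewrite normr0.
Qed.

Lemma integral_excess (t : R) :
  \int[mu]_x (Num.max ((x : R) - t) 0)%:E = (excess t)%:E.
Proof. by rewrite fineK//; apply: integrable_fin_num (integrable_excess t). Qed.

Lemma excess_ge0 t : (0 <= excess t)%R.
Proof.
rewrite -lee_fin -integral_excess; apply: integral_ge0 => x _.
by rewrite lee_fin le_max lexx orbT.
Qed.

(** Since the mean is 0, g(t) + t is the expectation of (t - gamma)^+. *)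
Lemma integral_lower_excess (t : R) :
  \int[mu]_x (Num.max (t - (x : R)) 0)%:E = (t + excess t)%:E.
Proof.
have -> : (t + excess t = excess t - (- t))%R by rewrite opprK addrC.
rewrite EFinB -integral_excess -integral_shift -integralB//=; last 2 first.
- exact: integrable_excess.
- exact: integrable_shift.
apply: eq_integral => x _; rewrite -EFinB; congr EFin.
by case: (leP ((x : R) - t)%R 0%R); case: (leP (t - (x : R))%R 0%R); lra.
Qed.

Lemma excess_geN t : (0 <= t + excess t)%R.
Proof.
rewrite -lee_fin -integral_lower_excess; apply: integral_ge0 => x _.
by rewrite lee_fin le_max lexx orbT.
Qed.

Lemma max_addE (a b x : R) :
  (Num.max a (x + b) = a + Num.max (x - (a - b)) 0)%R.
Proof. by case: (leP a (x + b)%R); case: (leP (x - (a - b))%R 0%R); lra. Qed.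

Lemma integrable_max_shift (a b : R) :
  mu.-integrable setT (fun x : measurableTypeR R => (Num.max a ((x : R) + b))%:E).
Proof.
have -> : (fun x : measurableTypeR R => (Num.max a ((x : R) + b))%:E) =
    cst a%:E \+ (fun x : measurableTypeR R => (Num.max ((x : R) - (a - b)) 0)%:E).
  by apply/funext => x /=; rewrite max_addE.
exact: integrableD (integrable_cst_prob a) (integrable_excess _).
Qed.

Lemma integral_max_shift (a b : R) :
  \int[mu]_x (Num.max a ((x : R) + b))%:E = (a + excess (a - b))%:E.
Proof.
rewrite EFinD -integral_excess.
under eq_integral do rewrite max_addE EFinD.
rewrite integralD//; [|exact: integrable_cst_prob|exact: integrable_excess].
by rewrite integral_cst_prob.
Qed.

(** (u - 2 s)^2 >= 0; this turns a second moment into a decay rate 1 / s of the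
    excess over the level s. *)
Lemma max_le_sq (u s : R) : (0 < s -> Num.max (u - s) 0 <= u ^+ 2 / (4 * s))%R.
Proof.
move=> s0; rewrite ge_max; have s4 : (0 < 4 * s)%R by rewrite mulr_gt0.
rewrite divr_ge0 ?sqr_ge0 ?(ltW s4)// andbT ler_pdivlMr// -subr_ge0.
by rewrite (_ : _ - _ = (u - 2 * s) ^+ 2)%R ?sqr_ge0//; ring.
Qed.

Section second_moment.
Context (m : R).
Hypothesis V : \int[mu]_x ((x - m) ^+ 2)%:E < +oo.

Lemma integral_le_sq_moment (f : R -> R) (s : R) : (0 < s)%R ->
  measurable_fun [set: measurableTypeR R] (f : measurableTypeR R -> R) ->
  (forall x, 0 <= f x <= (x - m) ^+ 2 / (4 * s))%R ->
  \int[mu]_x (f x)%:E <= (fine (\int[mu]_x ((x - m) ^+ 2)%:E) / (4 * s))%:E.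
Proof.
move=> s0 mf fle; have s4 : (0 <= (4 * s)^-1)%R by rewrite invr_ge0 mulr_ge0// ltW.
have V0 : 0 <= \int[mu]_x ((x - m) ^+ 2)%:E.
  by apply: integral_ge0 => x _; rewrite lee_fin sqr_ge0.
rewrite mulrC EFinM fineK ?ge0_fin_numE//.
rewrite -ge0_integralZl_EFin//; last 2 first.
- by move=> x _; rewrite lee_fin sqr_ge0.
- by apply/measurable_EFinP; exact: measurable_sq_sub.
apply: ge0_le_integral => //.
- by move=> x _; rewrite lee_fin; case/andP: (fle x).
- exact/measurable_EFinP.
- by apply/measurable_EFinP; apply: measurable_funM => //; exact: measurable_sq_sub.
- by move=> x _; rewrite -EFinM lee_fin mulrC; case/andP: (fle x).
Qed.

Let sq_moment := fine (\int[mu]_x ((x - m) ^+ 2)%:E).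

Lemma sq_moment_small (e : R) : (0 < e)%R ->
  exists2 s : R, (0 < s)%R & (sq_moment / (4 * s) <= e)%R.
Proof.
move=> e0; have V0 : (0 <= sq_moment)%R.
  by apply/fine_ge0/integral_ge0 => x _; rewrite lee_fin sqr_ge0.
exists ((sq_moment + 1) / (4 * e))%R; first by rewrite divr_gt0 ?mulr_gt0// ltr_wpDl.
rewrite ler_pdivrMr; last by rewrite !mulr_gt0// ?invr_gt0 ?mulr_gt0// ltr_wpDl.
suff -> : (e * (4 * ((sq_moment + 1) / (4 * e))) = sq_moment + 1)%R by rewrite lerDl.
by field; rewrite gt_eqF.
Qed.

Lemma excess_small e : (0 < e)%R -> exists t, (excess t <= e)%R.
Proof.
move=> /sq_moment_small[s s0 se]; exists (m + s)%R; apply: le_trans se.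
rewrite -lee_fin -integral_excess; apply: integral_le_sq_moment => //.
  exact: measurable_excess.
by move=> x; rewrite le_max lexx orbT opprD addrA max_le_sq.
Qed.

Lemma excessN_small e : (0 < e)%R -> exists t, (t + excess t <= e)%R.
Proof.
move=> /sq_moment_small[s s0 se]; exists (m - s)%R; apply: le_trans se.
rewrite -lee_fin -integral_lower_excess; apply: integral_le_sq_moment => //.
  by apply: measurable_maxr => //; exact: measurable_funB.
move=> x; rewrite le_max lexx orbT /= addrAC -sqrrN opprB.
exact: max_le_sq.
Qed.

End second_moment.

End one_coordinate.

(** * Integration against the joint law of independent coordinates *)

Section power_integral.
Context d (T : measurableType d) (R : realType) (mu : probability T R).
Local Open Scope ereal_scope.

(** Fubini for the joint law of n + 1 coordinates, peeling off the first one, for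
    non-negative and then for integrable functions. *)
Lemma ge0_integral_power_measureS n (F : n.+1.-tuple T -> \bar R) :
  measurable_fun setT F -> (forall c, 0 <= F c) ->
  \int[power_measure mu n.+1]_c F c =
  \int[mu]_z \int[power_measure mu n]_c F (tuple_cons (z, c)).
Proof.
move=> mF F0 /=; rewrite ge0_integral_distribution//.
rewrite (fubini_tonelli1 (F \o @tuple_cons _ T n))//.
  by apply: measurableT_comp => //; exact: measurable_tuple_cons.
by move=> zc; exact: F0.
Qed.

Lemma integrable_power_measureS n (F : n.+1.-tuple T -> \bar R) :
  (power_measure mu n.+1).-integrable setT F ->
  (mu \x power_measure mu n).-integrable setT (F \o @tuple_cons _ T n).
Proof.
move=> /integrableP[mF iF]; apply/integrableP; split.
  by apply: measurableT_comp => //; exact: measurable_tuple_cons.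
move: iF; rewrite /= ge0_integral_distribution//.
exact: measurableT_comp.
Qed.

Lemma integral_power_measureS n (F : n.+1.-tuple T -> \bar R) :
  (power_measure mu n.+1).-integrable setT F ->
  \int[power_measure mu n.+1]_c F c =
  \int[mu]_z \int[power_measure mu n]_c F (tuple_cons (z, c)).
Proof.
move=> iF; have iF' := integrable_power_measureS iF.
rewrite /= integral_distribution//; last exact: measurable_int iF.
by rewrite -(integral12_prod_meas1 iF').
Qed.

Lemma ge0_integral_power_sum n (h : 'I_n -> T -> R) :
  (forall i, measurable_fun setT (h i)) -> (forall i x, 0 <= h i x)%R ->
  \int[power_measure mu n]_c (\sum_(i < n) h i (tnth c i))%:E =
  \sum_(i < n) \int[mu]_x (h i x)%:E.
Proof.
elim: n h => [|n IHn] h mh h0.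
  by rewrite big_ord0; apply: integral0_eq => c _; rewrite big_ord0.
have msum k (f : 'I_k -> T -> R) : (forall i, measurable_fun setT (f i)) ->
    measurable_fun setT (fun c : k.-tuple T => \sum_(i < k) f i (tnth c i))%R.
  move=> mf; apply: measurable_sum => i.
  exact: (measurableT_comp (mf i) (measurable_tnth i)).
rewrite ge0_integral_power_measureS//; last 2 first.
- by apply/measurable_EFinP; exact: (msum _ h mh).
- by move=> c; rewrite lee_fin sumr_ge0.
have E z : \int[power_measure mu n]_c
      (\sum_(i < n.+1) h i (tnth (tuple_cons (z, c)) i))%:E =
    (h ord0 z)%:E + \sum_(i < n) \int[mu]_x (h (lift ord0 i) x)%:E.
  rewrite -IHn//.
  rewrite -[X in X + _]mule1 -(probability_setT (power_measure mu n)).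
  rewrite -(integral_cst (power_measure mu n) measurableT (h ord0 z)%:E).
  rewrite -ge0_integralD//; last 3 first.
  - by move=> c _; rewrite lee_fin.
  - by move=> c _; rewrite lee_fin sumr_ge0.
  - apply/measurable_EFinP; exact: (msum _ (fun i => h (lift ord0 i)) (fun i => mh _)).
  apply: eq_integral => c _; rewrite -EFinD big_ord_recl; congr (_ + _)%:E.
  by apply: eq_bigr => i _; rewrite tnthS.
under eq_integral do rewrite E.
rewrite ge0_integralD//; last 3 first.
- by move=> x _; rewrite lee_fin.
- exact/measurable_EFinP.
- by move=> x _; apply: sume_ge0 => i _; apply: integral_ge0 => y _; rewrite lee_fin.
rewrite big_ord_recl integral_cst//=.
by rewrite probability_setT mule1.
Qed.

End power_integral.

(** * The maximum of a random linear form over a set and over its faces *)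

Section support_function.
Context (R : realType).
Local Open Scope ereal_scope.

(** The support function of X, in the extended reals so that the recursion over
    faces holds for empty faces as well. *)
Definition maxdot n (X : {set n.-tuple bool}) (c : n.-tuple R) : \bar R :=
  \big[maxe/-oo]_(x in X) (dot c x)%:E.

Definition face n (b : bool) (X : {set n.+1.-tuple bool}) : {set n.-tuple bool} :=
  [set x : n.-tuple bool | [tuple of b :: x] \in X]%SET.

Lemma card_face n (X : {set n.+1.-tuple bool}) :
  #|X| = (#|face true X| + #|face false X|)%N.
Proof.
rewrite -!sum1_card.
have h : {on [pred x | x \in X], bijective
    (fun p : bool * n.-tuple bool => [tuple of p.1 :: p.2])}.
  exists (fun x : n.+1.-tuple bool => (thead x, [tuple of behead x])).
    by move=> [b y] _ /=; congr pair; apply: val_inj.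
  by move=> x _; rewrite [RHS]tuple_eta.
rewrite (reindex _ h) /=.
rewrite -(pair_big_dep xpredT (fun b (y : n.-tuple bool) => [tuple of b :: y] \in X)
  (fun _ _ => 1%N)) /= big_bool.
by congr (_ + _)%N; apply: eq_bigl => y; rewrite inE.
Qed.

Lemma dot_cons n (z : R) (c : n.-tuple R) b (y : n.-tuple bool) :
  dot [tuple of z :: c] [tuple of b :: y] = (z * b%:R + dot c y)%R.
Proof.
rewrite /dot big_ord_recl; congr (_ + _)%R.
by apply: eq_bigr => i _; rewrite !tnthS.
Qed.

Lemma maxdot_leP n (X : {set n.-tuple bool}) c (y : \bar R) :
  reflect (forall x, x \in X -> (dot c x)%:E <= y) (maxdot X c <= y).
Proof.
apply: (iffP idP) => [h x Xx|h].
  by apply: le_trans h; exact: le_bigmax_cond.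
by apply: bigmax_le => //; exact: leNye.
Qed.

Lemma maxdot_ge n (X : {set n.-tuple bool}) c x :
  x \in X -> (dot c x)%:E <= maxdot X c.
Proof. by move=> Xx; exact: le_bigmax_cond. Qed.

Lemma maxdot_eq0 n (X : {set n.-tuple bool}) (c : n.-tuple R) :
  #|X| = 0%N -> maxdot X c = -oo.
Proof. by move=> /cards0_eq ->; rewrite /maxdot big_set0. Qed.

Lemma maxdot_cons n (X : {set n.+1.-tuple bool}) z (c : n.-tuple R) :
  maxdot X [tuple of z :: c] =
  maxe (maxdot (face false X) c) (z%:E + maxdot (face true X) c).
Proof.
apply/eqP; rewrite eq_le; apply/andP; split.
  apply/maxdot_leP => x; rewrite (tuple_eta x) => Xx.
  rewrite dot_cons le_max; apply/orP.
  case: (thead x) Xx => Xx; [right|left].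
    by rewrite mulr1 EFinD leeD2l// maxdot_ge// inE.
  by rewrite mulr0 add0r maxdot_ge// inE.
rewrite ge_max; apply/andP; split.
  apply/maxdot_leP => y; rewrite inE => Xy.
  by apply: le_trans (maxdot_ge _ Xy); rewrite dot_cons mulr0 add0r.
rewrite addeC -leeBrDr//; apply/maxdot_leP => y; rewrite inE => Xy.
rewrite leeBrDr// addeC.
by apply: le_trans (maxdot_ge _ Xy); rewrite dot_cons mulr1.
Qed.

Lemma measurable_maxdot n (X : {set n.-tuple bool}) :
  measurable_fun [set: n.-tuple (measurableTypeR R)] (maxdot X).
Proof.
have mdot (x : n.-tuple bool) : measurable_fun [set: n.-tuple (measurableTypeR R)]
    (fun c : n.-tuple (measurableTypeR R) => (dot (c : n.-tuple R) x)%:E).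
  apply/measurable_EFinP; apply: measurable_sum => i.
  by apply: measurable_funM => //; exact: measurable_tnth.
rewrite /maxdot; elim: (index_enum _) => [|x s IHs].
  by under eq_fun do rewrite big_nil; exact: measurable_cst.
under eq_fun do rewrite big_cons.
by case: (x \in X) => //; exact: measurable_maxe.
Qed.

(** The l^1 norm of c dominates the support function of every non-empty X; this is
    the integrable bound for all the expectations below. *)
Lemma abse_maxdot n (X : {set n.-tuple bool}) c : (0 < #|X|)%N ->
  `|maxdot X c| <= (\sum_(i < n) `|tnth c i|)%:E.
Proof.
move=> /card_gt0P[x0 Xx0].
have le x : (`|dot c x| <= \sum_(i < n) `|tnth c i|)%R.
  apply: le_trans (ler_norm_sum _ _ _) _; apply: ler_sum => i _.
  by rewrite normrM; case: (tnth x i); rewrite ?normr1 ?mulr1// normr0 mulr0.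
have ge0 : (dot c x0)%:E <= maxdot X c by exact: maxdot_ge.
have leN : maxdot X c <= (\sum_(i < n) `|tnth c i|)%:E.
  by apply/maxdot_leP => x _; rewrite lee_fin (le_trans (ler_norm _)).
have fM : maxdot X c \is a fin_num.
  by apply: fin_real; rewrite (lt_le_trans (ltNyr _) ge0) (le_lt_trans leN (ltry _)).
move: ge0 leN; rewrite -(fineK fM) !lee_fin => ge0 leN.
rewrite ler_norml leN andbT.
by apply: le_trans ge0; move: (le x0); rewrite ler_norml => /andP[].
Qed.

End support_function.

Section gamma.
Context (R : realType) (mu : probability (measurableTypeR R) R).
Local Open Scope ereal_scope.
Hypothesis ix : mu.-integrable setT (fun x : measurableTypeR R => (x : R)%:E).
Hypothesis mean0 : \int[mu]_x (x : R)%:E = 0.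

Lemma integrable_maxdot n (X : {set n.-tuple bool}) : (0 < #|X|)%N ->
  (power_measure mu n).-integrable setT (maxdot X).
Proof.
move=> X0; apply/integrableP; split; first exact: measurable_maxdot.
apply: (@le_lt_trans _ _ (\int[power_measure mu n]_c
    (\sum_(i < n) `|tnth c i : R|)%:E)).
  apply: ge0_le_integral => //.
  - by apply: measurableT_comp => //; exact: measurable_maxdot.
  - apply/measurable_EFinP; apply: measurable_sum => i.
    by apply: measurableT_comp => //; exact: measurable_tnth.
  - by move=> c _; exact: abse_maxdot.
rewrite (@ge0_integral_power_sum _ _ _ mu n
  (fun=> fun x : measurableTypeR R => `|x : R|%R))//; last first.
  by move=> i; exact: measurableT_comp.
apply: lte_sum_pinfty => i _.
by move/integrableP : ix => [_].
Qed.

Lemma Gamma_fin_num n (X : {set n.-tuple bool}) : (0 < #|X|)%N ->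
  Gamma X mu \is a fin_num.
Proof. by move=> X0; apply: integrable_fin_num => //; exact: integrable_maxdot. Qed.

Lemma integrable_add_cst n (z : R) (X : {set n.-tuple bool}) : (0 < #|X|)%N ->
  (power_measure mu n).-integrable setT (fun c => z%:E + maxdot X c).
Proof.
move=> X0; apply: (@integrableD _ _ _ (power_measure mu n) _ measurableT (cst z%:E)) => //.
  exact: finite_measure_integrable_cst.
exact: integrable_maxdot.
Qed.

Lemma integral_add_cst n (z : R) (X : {set n.-tuple bool}) : (0 < #|X|)%N ->
  \int[power_measure mu n]_c (z%:E + maxdot X c) = z%:E + Gamma X mu.
Proof.
move=> X0; rewrite (@integralD _ _ _ (power_measure mu n) _ measurableT (cst z%:E))//; last 2 first.
- exact: finite_measure_integrable_cst.
- exact: integrable_maxdot.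
congr (_ + _); rewrite integral_cst// -[RHS]mule1; congr (_ * _).
exact: probability_setT.
Qed.

Lemma GammaS n (X : {set n.+1.-tuple bool}) : (0 < #|X|)%N ->
  Gamma X mu = \int[mu]_z \int[power_measure mu n]_c
    maxe (maxdot (face false X) c) ((z : R)%:E + maxdot (face true X) c).
Proof.
move=> X0; rewrite /Gamma (integral_power_measureS (integrable_maxdot X0)).
by apply: eq_integral => z _; apply: eq_integral => c _; rewrite -maxdot_cons.
Qed.

(** The Jensen step: the inner expectation, over the remaining coordinates, of a
    maximum is at least the maximum of the expectations. *)
Lemma Gamma_face n (X : {set n.+1.-tuple bool}) (G0 G1 : R) :
  (0 < #|face false X|)%N -> (0 < #|face true X|)%N ->
  Gamma (face false X) mu = G0%:E -> Gamma (face true X) mu = G1%:E ->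
  (G0 + excess mu (G0 - G1))%:E <= Gamma X mu.
Proof.
move=> X0 X1 E0 E1.
have XX : (0 < #|X|)%N by rewrite card_face addn_gt0 X0 orbT.
have iX := integrable_fubini_F (integrable_power_measureS (integrable_maxdot XX)).
rewrite GammaS// -(integral_max_shift ix).
apply: le_integral => //.
- exact: integrable_max_shift.
- apply: eq_integrable iX => // z _; apply: eq_integral => c _ /=.
  by rewrite -maxdot_cons.
have ile (z : R) : (power_measure mu n).-integrable setT (fun c =>
    maxe (maxdot (face false X) c) (z%:E + maxdot (face true X) c)).
  have i0 := integrable_abse (integrable_maxdot X0).
  have i1 := integrable_abse (integrable_add_cst z X1).
  apply: (le_integrable measurableT _ _ (integrableD measurableT i0 i1)).
    apply: measurable_maxe; first exact: measurable_maxdot.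
    exact: measurable_int (integrable_add_cst z X1).
  move=> c _ /=; rewrite [leRHS]gee0_abs ?adde_ge0//.
  by rewrite maxEle; case: ifP => _; [rewrite leeDr|rewrite leeDl].
move=> z _; rewrite EFin_max ge_max; apply/andP; split.
  rewrite -E0; apply: le_integral => //; first exact: integrable_maxdot.
  by move=> c _; rewrite le_max lexx.
rewrite EFinD -E1 -integral_add_cst//; apply: le_integral => //.
  exact: integrable_add_cst.
by move=> c _; rewrite le_max lexx orbT.
Qed.

End gamma.

(** * Lower and upper bounds for Gamma *)

Section gamma_bounds.
Context (R : realType) (mu : probability (measurableTypeR R) R).
Local Open Scope ereal_scope.
Hypothesis ix : mu.-integrable setT (fun x : measurableTypeR R => (x : R)%:E).
Hypothesis mean0 : \int[mu]_x (x : R)%:E = 0.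

(** If the first coordinate is constant on X, then dropping it changes the maximum by
    a random term of mean 0. *)
Lemma Gamma_face_false n (X : {set n.+1.-tuple bool}) :
  #|face true X| = 0%N -> (0 < #|X|)%N -> Gamma X mu = Gamma (face false X) mu.
Proof.
move=> X1 X0; rewrite (GammaS ix)//.
have E (z : R) : \int[power_measure mu n]_c
    maxe (maxdot (face false X) c) (z%:E + maxdot (face true X) c) =
  Gamma (face false X) mu.
  by apply: eq_integral => c _; rewrite (maxdot_eq0 c X1) addeNy maxeNy.
under eq_integral do rewrite E.
rewrite integral_cst// -[RHS]mule1; congr (_ * _); exact: probability_setT.
Qed.

Lemma Gamma_face_true n (X : {set n.+1.-tuple bool}) :
  #|face false X| = 0%N -> (0 < #|X|)%N -> Gamma X mu = Gamma (face true X) mu.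
Proof.
move=> F0 X0.
have F1 : (0 < #|face true X|)%N by move: X0; rewrite card_face F0 addn0.
rewrite (GammaS ix)//.
have E (z : R) : \int[power_measure mu n]_c
    maxe (maxdot (face false X) c) (z%:E + maxdot (face true X) c) =
  z%:E + Gamma (face true X) mu.
  rewrite -(integral_add_cst ix)//; apply: eq_integral => c _.
  by rewrite (maxdot_eq0 c F0) maxNye.
under eq_integral do rewrite E.
have /fineK <- := Gamma_fin_num ix F1.
rewrite integralD//; last exact: integrable_cst_prob.
by rewrite mean0 add0e integral_cst_prob.
Qed.

(** The inequality a H - b <= psi between functions of one variable propagates to
    all dimensions. Non-negativity of b says that the line a h - b passes below
    the origin; it serves when one of the faces is empty. *)
Lemma Gamma_lower (a b : R) : (0 <= b)%R ->
  (forall p t : R, 0 <= p <= 1 -> a * entropy p - b <= p * t + excess mu t)%R ->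
  forall n (X : {set n.-tuple bool}), (0 < #|X|)%N ->
  (a * ln #|X|%:R - b * n%:R)%:E <= Gamma X mu.
Proof.
move=> b0 ab; elim=> [|n IHn] X X0.
  have -> : #|X| = 1%N.
    apply/eqP; rewrite eqn_leq X0 andbT (leq_trans (max_card _))//.
    by rewrite card_tuple expn0.
  rewrite ln1 !mulr0 subr0.
  have [x Xx] := card_gt0P X0; apply: integral_ge0 => c _.
  by apply: le_trans (maxdot_ge c Xx); rewrite lee_fin /dot big_ord0.
have nb : (a * ln #|X|%:R - b * n.+1%:R <= a * ln #|X|%:R - b * n%:R)%R.
  by rewrite lerD2l lerN2 ler_wpM2l// ler_nat.
have [F1|F1] := posnP #|face true X|.
  have E : #|X| = #|face false X| by rewrite card_face F1.
  rewrite Gamma_face_false//; apply: (le_trans _ (IHn _ _)); last by rewrite -E.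
  by rewrite lee_fin -E.
have [F0|F0] := posnP #|face false X|.
  have E : #|X| = #|face true X| by rewrite card_face F0 addn0.
  rewrite Gamma_face_true//; apply: (le_trans _ (IHn _ _)) => //.
  by rewrite lee_fin -E.
have /fineK E0 := Gamma_fin_num ix F0; have /fineK E1 := Gamma_fin_num ix F1.
have h0 := IHn _ F0; have h1 := IHn _ F1.
rewrite -E0 lee_fin in h0; rewrite -E1 lee_fin in h1.
apply: le_trans (Gamma_face ix F0 F1 (esym E0) (esym E1)).
set G0 := fine _ in h0 *; set G1 := fine _ in h1 *.
rewrite lee_fin.
have k0 : (0 < #|face false X|%:R :> R)%R by rewrite ltr0n.
have k1 : (0 < #|face true X|%:R :> R)%R by rewrite ltr0n.
have kE : (#|X|%:R = #|face false X|%:R + #|face true X|%:R :> R)%R.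
  by rewrite card_face addnC natrD.
(* The probability that the first coordinate of a uniform point of X is 1. *)
set p : R := (#|face true X|%:R / (#|face false X|%:R + #|face true X|%:R))%R.
have p01 : (0 <= p <= 1)%R.
  rewrite divr_ge0 ?addr_ge0//= ler_pdivrMr ?addr_gt0// mul1r lerDr//.
have := ab p (G0 - G1)%R p01.
have := entropy_chain k0 k1; rewrite -kE -/p.
rewrite kE -/p -kE => chain.
case/andP: p01 => p0 p1.
have := ler_wpM2l p0 h1; have := ler_wpM2l (_ : 0 <= 1 - p)%R h0.
rewrite subr_ge0 => /(_ p1) h0' h1' hp.
rewrite -natr1.
have := congr1 ( *%R a) chain.
lra.
Qed.

(** Thresholds tau bound the linear form pointwise by
    sum_i tau_i x_i + sum_i (c_i - tau_i)^+, where the second sum no longer depends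
    on x. *)
Lemma Gamma_upper n (X : {set n.-tuple bool}) (tau : 'I_n -> R) (c : R) :
  (0 < #|X|)%N ->
  (forall x, x \in X -> \sum_(i < n) tau i * (tnth x i)%:R <= c)%R ->
  Gamma X mu <= (c + \sum_(i < n) excess mu (tau i))%:E.
Proof.
move=> X0 Xc.
pose h (i : 'I_n) (x : measurableTypeR R) := Num.max ((x : R) - tau i)%R 0%R.
have h0 i x : (0 <= h i x)%R by rewrite le_max lexx orbT.
have mh i : measurable_fun setT (h i) by exact: measurable_excess.
have ih : (power_measure mu n).-integrable setT
    (fun v => (\sum_(i < n) h i (tnth v i))%:E).
  apply/integrableP; split.
    apply/measurable_EFinP; apply: measurable_sum => i.
    exact: (measurableT_comp (mh i) (measurable_tnth i)).
  under eq_integral do rewrite gee0_abs ?lee_fin ?sumr_ge0//.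
  rewrite ge0_integral_power_sum//; apply: lte_sum_pinfty => i _.
  by rewrite (integral_excess ix) ltry.
have -> : (c + \sum_(i < n) excess mu (tau i))%:E =
    \int[power_measure mu n]_v (cst c%:E v + (\sum_(i < n) h i (tnth v i))%:E).
  rewrite integralD//; last exact: finite_measure_integrable_cst.
  rewrite ge0_integral_power_sum// EFinD -sumEFin; congr (_ + _).
    by rewrite integral_cst// -[LHS]mule1; congr (_ * _); exact/esym/probability_setT.
  by apply: eq_bigr => i _; rewrite (integral_excess ix).
apply: le_integral => //.
- exact: integrable_maxdot.
- apply: integrableD => //; exact: finite_measure_integrable_cst.
move=> v _; apply/maxdot_leP => x Xx; rewrite -EFinD lee_fin.
apply: le_trans (lerD (Xc _ Xx) (lexx _)); rewrite -big_split /=.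
apply: ler_sum => i _; rewrite /h.
by case: (tnth x i); rewrite ?mulr1 ?mulr0; case: (leP (tnth v i - tau i)%R 0%R); lra.
Qed.

End gamma_bounds.

(** * Products of Hamming spheres *)

Lemma littleo_linearP (R : realType) (f : nat -> R) (c : R) :
  (fun n => f n - c * n%:R : R) =o_\oo (fun n => n%:R : R) <->
  f n / n%:R @[n --> \oo] --> c.
Proof.
rewrite littleo_natP.
have E : {near \oo, (fun n => (f n - c * n%:R) / n%:R) =1 (fun n => f n / n%:R - c)}.
  near=> n; have n0 : (n%:R : R) != 0.
    by rewrite pnatr_eq0 -lt0n; near: n; exact: nbhs_infty_gt.
  by rewrite mulrBl mulfK.
split=> h.
  have -> : c = 0 + c by rewrite add0r.
  under eq_fun do rewrite -(subrK c (f _ / _)).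
  apply: cvgD; last exact: cvg_cst.
  exact: cvg_trans (near_eq_cvg E) h.
apply: (cvg_trans (near_eq_cvg _) (_ : (fun n => f n / n%:R - c) @ \oo --> 0)).
  by apply: filterS E.
by rewrite -(subrr c); apply: cvgB => //; exact: cvg_cst.
Unshelve. all: by end_near.
Qed.

Lemma card_hamming_sphere d r : #|hamming_sphere d r| = 'C(d, r).
Proof.
rewrite -[d in 'C(d, _)]card_ord -card_draws.
pose f (A : {set 'I_d}) := [tuple i \in A | i < d].
have fI : injective f.
  move=> A B /(congr1 (fun t => tnth t)) AB; apply/setP => i.
  by have := congr1 (fun g => g i) AB; rewrite !tnth_mktuple.
rewrite -(card_imset _ fI); apply: eq_card => x; apply/idP/imsetP.
  rewrite inE => /eqP xr; exists [set i | tnth x i]%SET.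
    rewrite inE -sum1dep_card -xr; apply/eqP; rewrite [RHS](bigID (tnth x)) /=.
    rewrite [X in (_ + X)%N]big1 ?addn0; last by move=> i /negbTE ->.
    by apply: eq_bigr => i ->.
  by apply: eq_from_tnth => i; rewrite tnth_mktuple inE.
move=> [A]; rewrite inE => /eqP Ar ->; rewrite inE -Ar -sum1_card.
apply/eqP; rewrite (bigID (fun i => i \in A)) /= addnC big1 ?add0n.
  by apply: eq_bigr => i iA; rewrite tnth_mktuple iA.
by move=> i /negbTE iA; rewrite tnth_mktuple iA.
Qed.

Lemma cube_prodE d1 d2 (A : {set d1.-tuple bool}) (B : {set d2.-tuple bool}) :
  cube_prod (d1 + d2) A B =
  [set [tuple of p.1 ++ p.2] | p : d1.-tuple bool * d2.-tuple bool
                             in finset.setX A B]%SET.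
Proof.
apply/setP => z; rewrite inE; apply/exists_inP/imsetP.
  move=> [x Ax /exists_inP[y By /eqP zE]]; exists (x, y); first by rewrite inE Ax.
  exact: val_inj.
move=> [[x y]]; rewrite inE /= => /andP[Ax By] ->.
by exists x => //; apply/exists_inP; exists y.
Qed.

Lemma card_cube_prod n d1 d2 (A : {set d1.-tuple bool}) (B : {set d2.-tuple bool}) :
  (d1 + d2)%N = n -> #|cube_prod n A B| = (#|A| * #|B|)%N.
Proof.
move=> <-; rewrite cube_prodE card_imset ?cardsX// => -[x y] [x' y'] /= /(congr1 val) /=.
move/eqP; rewrite eqseq_cat ?size_tuple// => /andP[/eqP xx /eqP yy].
by congr pair; exact: val_inj.
Qed.

Lemma sum_cat_tuple (V : nmodType) d1 d2 (x : d1.-tuple bool) (y : d2.-tuple bool)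
    (F G : bool -> V) :
  \sum_(i < d1 + d2) (if (i < d1)%N then F else G) (tnth [tuple of x ++ y] i) =
  \sum_(i < d1) F (tnth x i) + \sum_(i < d2) G (tnth y i).
Proof.
rewrite big_split_ord; congr (_ + _); apply: eq_bigr => i _.
  by rewrite /= ltn_ord (tnth_nth false) /= nth_cat size_tuple ltn_ord -tnth_nth.
rewrite /= ltnNge leq_addr /= (tnth_nth false) /= nth_cat size_tuple.
by rewrite ltnNge leq_addr /= addKn -tnth_nth.
Qed.

Lemma Gamma_product_spheres (R : realType) (mu : probability (measurableTypeR R) R)
  (n d1 d2 r1 r2 : nat) (t1 t2 : R) :
  mu.-integrable setT (fun x : measurableTypeR R => (x : R)%:E) ->
  (r1 <= d1)%N -> (r2 <= d2)%N -> (d1 + d2)%N = n ->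
  (Gamma (cube_prod n (hamming_sphere d1 r1) (hamming_sphere d2 r2)) mu <=
   ((t1 * r1%:R + d1%:R * excess mu t1) + (t2 * r2%:R + d2%:R * excess mu t2))%:E)%E.
Proof.
move=> ix rd1 rd2 dn.
have Y0 : (0 < #|cube_prod n (hamming_sphere d1 r1) (hamming_sphere d2 r2)|)%N.
  by rewrite card_cube_prod// !card_hamming_sphere muln_gt0 !bin_gt0 rd1.
subst n; pose tau (i : 'I_(d1 + d2)) := if (i < d1)%N then t1 else t2.
have := @Gamma_upper _ mu ix _ _ tau (t1 * r1%:R + t2 * r2%:R) Y0.
rewrite (_ : \sum_i excess mu (tau i) = d1%:R * excess mu t1 + d2%:R * excess mu t2).
  rewrite addrACA; apply.
  move=> _ /[!cube_prodE]/imsetP[[x y] /[!inE]/= /andP[/eqP xr /eqP yr] ->].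
  have := sum_cat_tuple x y (fun b => t1 * b%:R) (fun b => t2 * b%:R).
  rewrite -!mulr_sumr -!natr_sum xr yr => <-.
  by apply: ler_sum => i _; rewrite /tau; case: ifP.
rewrite big_split_ord /= /tau; congr (_ + _).
  under eq_bigr do rewrite /= ltn_ord.
  by rewrite sumr_const card_ord mulr_natl.
under eq_bigr do rewrite /= ltnNge leq_addr /=.
by rewrite sumr_const card_ord mulr_natl.
Qed.

(** * The extremal products of spheres *)

Unset Implicit Arguments.
Theorem theorem8p1 (R : realType) (mu : probability (measurableTypeR R) R)
    (alpha : R)
    (mu_sym : symmetric_measure mu)
    (mu_var : ('V_mu[(idfun : measurableTypeR R -> R)] < +oo)%E)
    (alpha_gt0 : 0 < alpha) (alpha_lt : alpha < ln 2) :
  exists beta1 beta2 lambda1 lambda2 : R,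
    0 <= beta1 <= lambda1 /\ 0 <= beta2 <= lambda2 /\ lambda1 + lambda2 = 1 /\
    forall r1 r2 d1 d2 : nat -> nat,
      (forall n, (r1 n <= d1 n)%N) ->
      (forall n, (r2 n <= d2 n)%N) ->
      (forall n, (d1 n + d2 n)%N = n) ->
      (fun n => (r1 n)%:R - beta1 * n%:R : R) =o_\oo (fun n => n%:R : R) ->
      (fun n => (r2 n)%:R - beta2 * n%:R : R) =o_\oo (fun n => n%:R : R) ->
      (fun n => (d1 n)%:R - lambda1 * n%:R : R) =o_\oo (fun n => n%:R : R) ->
      (fun n => (d2 n)%:R - lambda2 * n%:R : R) =o_\oo (fun n => n%:R : R) ->
      let Y n : {set n.-tuple bool} :=
        cube_prod n (hamming_sphere (d1 n) (r1 n))
                    (hamming_sphere (d2 n) (r2 n)) in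
      (fun n => ln #|Y n|%:R - alpha * n%:R : R) =o_\oo (fun n => n%:R : R) /\
      forall X : forall n, {set n.-tuple bool},
        (forall n, (0 < #|X n|)%N) ->
        (fun n => ln #|X n|%:R - alpha * n%:R : R) =o_\oo
          (fun n => n%:R : R) ->
        exists2 e : nat -> R, e =o_\oo (fun n => n%:R : R) &
          forall n, (Gamma (Y n) mu <= Gamma (X n) mu + (e n)%:E)%E.


Proof.
have [m V] := sq_moment_of_variance mu_var.
have ix := integrable_id V.
have mean0 := mean_symmetric mu_sym ix.
have g0 := excess_ge0 ix; have gN := excess_geN ix mean0.
have gs := excess_small ix V; have gNs := excessN_small ix mean0 V.
have in01 (p : R) : (`[0, 1]%classic p : Prop) <-> 0 <= p <= 1.
  by rewrite /= in_itv.
have cH : continuous (@entropy R).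
  move=> x; apply: cvgB; first by apply: cvgN; exact: continuous_xlnx.
  apply: (continuous_comp (f := fun p : R => 1 - p)); last exact: continuous_xlnx.
  by apply: cvgB; [exact: cvg_cst|exact: cvg_id].
have [||||a [b [l [p1 [p2 [[p1K p2K] l01 lH ab [ap1 ap2]]]]]]] :=
  @supporting_chord R R `[0, 1]%classic (@entropy R) (conj_excess (excess mu))
    alpha 0 2^-1
    (@segment_compact R 0 1) (@Rhausdorff R) cH (continuous_conj_excess g0 gN gs gNs).
- by move=> p /in01 p01; exact: conj_excess_ge0.
- by apply/in01; rewrite lexx ler01.
- by apply/in01; lra.
- by rewrite entropy0 entropy_half alpha_gt0 alpha_lt.
move/in01 : p1K => p1K; move/in01 : p2K => p2K.
have gab (p t : R) : 0 <= p <= 1 -> a * entropy p - b <= p * t + excess mu t.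
  move=> p01; apply: le_trans (conj_excess_le g0 gN t p01).
  by apply: ab; apply/in01.
(* At p = 0 the line is below psi 0 = inf g = 0. *)
have b0 : 0 <= b.
  apply/ler_addgt0Pr => e e0; have [t ht] := gs e e0.
  have := gab 0 t; rewrite lexx ler01 => /(_ isT).
  rewrite entropy0 mul0r mulr0; lra.
have lower := Gamma_lower ix mean0 b0 gab.
have /andP[l0 l1] := l01; have /andP[p10 p11] := p1K; have /andP[p20 p21] := p2K.
have l1' : 0 <= 1 - l by rewrite subr_ge0.
exists (l * p1), ((1 - l) * p2), l, (1 - l).
split; first by rewrite mulr_ge0//= ler_piMr.
split; first by rewrite mulr_ge0//= ler_piMr.
split; first by rewrite subrKC.
move=> r1 r2 d1 d2 rd1 rd2 dd /littleo_linearP cr1 /littleo_linearP cr2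
  /littleo_linearP cd1 /littleo_linearP cd2 Y.
have cardY n : #|Y n| = ('C(d1 n, r1 n) * 'C(d2 n, r2 n))%N.
  by rewrite card_cube_prod// !card_hamming_sphere.
split.
  apply/littleo_linearP.
  have -> : (fun n => ln #|Y n|%:R / n%:R) =
      (fun n => ln 'C(d1 n, r1 n)%:R / n%:R + ln 'C(d2 n, r2 n)%:R / n%:R) :> (nat -> R).
    apply/funext => n; rewrite cardY natrM -mulrDl lnM// posrE ltr0n bin_gt0//.
  rewrite -lH -(ln_bin_rate_entropy l0 p1K) -(ln_bin_rate_entropy l1' p2K).
  apply: cvgD; apply: cvg_ln_bin => // n.
    by rewrite rd1 -{2}(dd n) leq_addr.
  by rewrite rd2 -{2}(dd n) leq_addl.
move=> X X0 /littleo_linearP cX.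
have Y0 n : (0 < #|Y n|)%N by rewrite cardY muln_gt0 !bin_gt0 rd1 rd2.
have fY n : (fine (Gamma (Y n) mu))%:E = Gamma (Y n) mu.
  by apply: fineK; exact: Gamma_fin_num.
have fX n : (fine (Gamma (X n) mu))%:E = Gamma (X n) mu.
  by apply: fineK; exact: Gamma_fin_num.
(* The smallest non-negative admissible error; it remains to see that it is o(n). *)
exists (fun n => Num.max 0 (fine (Gamma (Y n) mu) - fine (Gamma (X n) mu))); last first.
  move=> n; rewrite -fY -fX -EFinD lee_fin -lerBlDl.
  by rewrite le_max lexx orbT.
rewrite eqoP => e e0.
have e2 : 0 < e / 2 by rewrite divr_gt0.
have [t1 ht1] := conj_excess_near g0 gN p1K e2.
have [t2 ht2] := conj_excess_near g0 gN p2K e2.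
(* The difference between the upper bound for Y n, with the thresholds t1 and t2,
   and the lower bound for X n. *)
pose D n : R := ((t1 * (r1 n)%:R + (d1 n)%:R * excess mu t1) +
  (t2 * (r2 n)%:R + (d2 n)%:R * excess mu t2)) - (a * ln #|X n|%:R - b * n%:R).
have cD : D n / n%:R @[n --> \oo] -->
    ((t1 * (l * p1) + l * excess mu t1) +
     (t2 * ((1 - l) * p2) + (1 - l) * excess mu t2)) -
    (a * alpha - b).
  have : (t1 * ((r1 n)%:R / n%:R) + (d1 n)%:R / n%:R * excess mu t1) +
     (t2 * ((r2 n)%:R / n%:R) + (d2 n)%:R / n%:R * excess mu t2) -
     (a * (ln #|X n|%:R / n%:R) - b) @[n --> \oo] -->
    ((t1 * (l * p1) + l * excess mu t1) +
     (t2 * ((1 - l) * p2) + (1 - l) * excess mu t2)) -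
    (a * alpha - b).
    apply: cvgB; last by apply: cvgB; [apply: cvgM => //; exact: cvg_cst|exact: cvg_cst].
    by apply: cvgD; apply: cvgD; apply: cvgM => //; exact: cvg_cst.
  apply: cvg_trans; apply: near_eq_cvg; near=> n.
  have n0 : (n%:R : R) != 0.
    by rewrite pnatr_eq0 -lt0n; near: n; exact: nbhs_infty_gt.
  by rewrite /D; field.
have clt : ((t1 * (l * p1) + l * excess mu t1) +
     (t2 * ((1 - l) * p2) + (1 - l) * excess mu t2)) -
    (a * alpha - b) < e.
  have : l * (p1 * t1 + excess mu t1) + (1 - l) * (p2 * t2 + excess mu t2) <=
         l * (conj_excess (excess mu) p1 + e / 2) +
         (1 - l) * (conj_excess (excess mu) p2 + e / 2).
    by rewrite lerD// ler_wpM2l.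
  rewrite -ap1 -ap2 -lH; lra.
have Dlt : \forall n \near \oo, D n / n%:R < e by apply: cvgr_lt clt; exact: cD.
near=> n.
have nR : 0 < n%:R :> R by rewrite ltr0n; near: n; exact: nbhs_infty_gt.
rewrite ger0_norm ?le_max ?lexx//= normr_nat ge_max mulr_ge0 ?(ltW e0)//=.
have : D n / n%:R < e by near: n.
rewrite ltr_pdivrMr// => /ltW; apply: le_trans.
apply: lerB; rewrite -lee_fin ?fY ?fX; last exact: lower.
exact: Gamma_product_spheres.
Unshelve. all: by end_near.
Qed.
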